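(* Let $n>s>0$ be integers, let $X$ be an $n$-element set, and let $\mathscr{A},\mathscr{B}\subset 2^X$ be nonempty families that are cross $s$-union. Then $$|\mathscr{A}|+|\mathscr{B}|\le 1+\sum_{0\le i\le s}\binom{n}{i},$$ and equality holds if $\{\mathscr{A},\mathscr{B}\}=\left\{\{\emptyset\},\{F\subset X:|F|\le s\}\right\}$. Furthermore, if $s<n-1$, this is the unique pair of families for which equality holds (that is, equality holds only if $\{\mathscr{A},\mathscr{B}\}=\left\{\{\emptyset\},\{F\subset X:|F|\le s\}\right\}$).
   Context: $2^X$ is the power set of $X$. Families $\mathscr{A},\mathscr{B}\subset 2^X$ are cross $s$-union if $|A\cup B|\le s$ for all $A\in\mathscr{A}$, $B\in\mathscr{B}$. *)

(* Defs.v *)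
From mathcomp Require Import all_boot.

Set Implicit Arguments.
Unset Strict Implicit.
Unset Printing Implicit Defensive.

Definition cross_union (T : finType) (s : nat) (A B : {set {set T}}) : Prop :=
  forall F G : {set T}, F \in A -> G \in B -> #|F :|: G| <= s.

Definition sets_upto (T : finType) (s : nat) : {set {set T}} :=
  [set F : {set T} | #|F| <= s].

(* Main.v *)
Require Import Defs.
From mathcomp Require Import all_boot.
From mathcomp Require Import zify.

(** Write [S(n, s)] for the number of subsets of size at most [s] of an [n]-set.
    Every member of either family has size at most [s], since a union with a
    member of the other family does.  Hence, if the families share at most the
    empty set, [#|A| + #|B| = #|A :|: B| + #|A :&: B| <= S(n, s) + 1] at once.

    Otherwise some point [x] lies in a common member.  Delete [x] from all
    members of [A] (the trace), and keep from [B] only the members through [x],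
    with [x] deleted (the link).  A union of a trace member and a link member
    has lost [x], so these two families are cross [(s-1)]-union on [n-1] points;
    so are the link of [A] and the trace of [B].  All four families are nonempty
    and a family is at most as large as its trace and link together, so
    induction on [s] gives
    [#|A| + #|B| <= 2 (1 + S(n-1, s-1)) = 2 + S(n, s) - 'C(n-1, s)]
    (lemma [cross_union_overlap]).  As [s <= n-1], the binomial coefficient is
    positive and the bound follows.

    If [0 < s < n-1] the binomial coefficient is at least 2, and the overlapping
    case is strict.  So at equality the families meet exactly in the empty set
    and together contain all sets of size at most [s].  Two distinct [s]-sets
    have a union of size more than [s], so one family contains every [s]-set
    (lemma [layer_in_one_family]); the other then has only the empty set, since
    any nonempty set sticks out of some [s]-set. *)

Set Implicit Arguments.
Unset Strict Implicit.
Unset Printing Implicit Defensive.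

(** * Counting small sets *)

Definition binsum (n s : nat) : nat := \sum_(0 <= i < s.+1) 'C(n, i).

Lemma binsumS n s : binsum n s.+1 = binsum n s + 'C(n, s.+1).
Proof. by rewrite /binsum big_nat_recr. Qed.

Lemma binsum_pascal n s : binsum n.+1 s.+1 = binsum n s.+1 + binsum n s.
Proof.
elim: s => [|s IHs].
  by rewrite /binsum !big_nat_recr //= !big_geq // !bin0 !bin1; lia.
by rewrite binsumS IHs binS !binsumS; lia.
Qed.

Lemma card_subsets_upto (T : finType) (Y : {set T}) s :
  #|[set F : {set T} | F \subset Y & #|F| <= s]| = binsum #|Y| s.
Proof.
elim: s => [|s IHs].
  rewrite /binsum big_nat1 -cards_draws; apply: eq_card => F.
  by rewrite !inE leqn0.
rewrite binsumS -IHs -cards_draws -cardsUI.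
rewrite [X in _ = _ + X](_ : _ = 0) ?addn0; last first.
  apply/eqP; rewrite cards_eq0; apply/eqP/setP => F; rewrite !inE.
  by case: eqP => [->|]; rewrite ?ltnn ?andbF.
by apply: eq_card => F; rewrite !inE -andb_orr leq_eqVlt orbC.
Qed.

Lemma card_sets_upto (T : finType) s : #|sets_upto T s| = binsum #|T| s.
Proof.
by rewrite -cardsT -card_subsets_upto; apply: eq_card => F;
  rewrite !inE subsetT.
Qed.

Lemma bin_ge2 m k : 0 < k < m -> 1 < 'C(m, k).
Proof.
case: m k => [|m] [|k] //=; rewrite ?andbF // ltnS => lt_km.
by rewrite binS -[2]/(1 + 1) leq_add // bin_gt0 // ltnW.
Qed.

(** * Traces and links *)

Section CrossUnion.
Variable T : finType.
Implicit Types (A B : {set {set T}}) (F G Y : {set T}) (x : T) (s : nat).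

Definition trace x A := [set F :\ x | F in A].
Definition link x A := [set F :\ x | F in [set F in A | x \in F]].

(** Members avoiding [x] survive in the trace, members through [x] correspond
    to the link.  The trace is used in place of the subfamily avoiding [x]
    because it is never empty when [A] is not. *)
Lemma card_trace_link x A : #|A| <= #|trace x A| + #|link x A|.
Proof.
rewrite -(cardsID [set F : {set T} | x \in F] A) addnC leq_add //.
  apply: subset_leq_card; apply/subsetP => F; rewrite !inE => /andP[xF FA].
  by apply/imsetP; exists F => //; apply/esym/setDidPl; rewrite disjoint_sym disjoints1.
rewrite card_in_imset; first by
  apply: subset_leq_card; apply/subsetP => F; rewrite !inE.
move=> F G; rewrite !inE => /andP[_ xF] /andP[_ xG] eqFG.
by rewrite -(setD1K xF) -(setD1K xG) eqFG.
Qed.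

Lemma link_neq0 x A F : F \in A -> x \in F -> link x A != set0.
Proof.
by move=> FA xF; apply/set0Pn; exists (F :\ x); apply: imset_f; rewrite inE FA.
Qed.

Lemma trace_neq0 x A F : F \in A -> trace x A != set0.
Proof. by move=> FA; apply/set0Pn; exists (F :\ x); apply: imset_f. Qed.

Lemma trace_powerset x A Y :
  A \subset powerset Y -> trace x A \subset powerset (Y :\ x).
Proof.
move=> /subsetP AY; apply/subsetP => _ /imsetP[F /AY + ->].
by rewrite !powersetE; apply: setSD.
Qed.

Lemma link_powerset x A Y :
  A \subset powerset Y -> link x A \subset powerset (Y :\ x).
Proof.
move=> AY; apply: subset_trans (trace_powerset x AY); apply: imsetS.
by apply/subsetP => F; rewrite inE => /andP[].
Qed.

Lemma cross_union_sym s A B : cross_union s A B -> cross_union s B A.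
Proof. by move=> AB F G FB GA; rewrite setUC; apply: AB. Qed.

(** The link member contributes [x] to the original union, so deleting [x]
    costs the union one element even where the trace member missed [x]. *)
Lemma cross_union_trace_link s x A B :
  cross_union s.+1 A B -> cross_union s (trace x A) (link x B).
Proof.
move=> AB F1 G1 /imsetP[F FA ->] /imsetP[G + ->]; rewrite inE => /andP[GB xG].
rewrite -setDUl -ltnS; apply: leq_trans (AB _ _ FA GB).
by rewrite [X in _ <= X](cardsD1 x) inE xG orbT.
Qed.

Lemma cross_union_small s A B :
  B != set0 -> cross_union s A B -> A \subset sets_upto T s.
Proof.
move=> /set0Pn[G GB] AB; apply/subsetP => F FA; rewrite inE.
exact: leq_trans (subset_leq_card (subsetUl F G)) (AB _ _ FA GB).
Qed.

(** * The bound *)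

(** The ground set is a subset [Y] of [T], so that deleting a point in the
    induction shrinks [Y] and leaves the type alone. *)
Definition bounded_at s : Prop := forall Y A B,
  s < #|Y| -> A \subset powerset Y -> B \subset powerset Y ->
  A != set0 -> B != set0 -> cross_union s A B ->
  #|A| + #|B| <= 1 + binsum #|Y| s.

(** The induction step, stated with its exact gain ['C(#|Y|.-1, s.+1)], because
    that gain decides whether equality is possible for overlapping families. *)
Lemma cross_union_overlap s Y A B F x :
  bounded_at s -> s.+1 < #|Y| -> A \subset powerset Y -> B \subset powerset Y ->
  F \in A -> F \in B -> x \in F -> cross_union s.+1 A B ->
  #|A| + #|B| + 'C(#|Y|.-1, s.+1) <= 2 + binsum #|Y| s.+1.
Proof.
move=> IHs ltsY AY BY FA FB xF AB.
have xY : x \in Y by move: (subsetP AY _ FA); rewrite powersetE => /subsetP; apply.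
have cardY : #|Y| = #|Y :\ x|.+1 by rewrite (cardsD1 x) xY.
have lts : s < #|Y :\ x| by rewrite -ltnS -cardY.
have le1 := IHs _ _ _ lts (trace_powerset x AY) (link_powerset x BY)
  (trace_neq0 x FA) (link_neq0 FB xF) (cross_union_trace_link (x := x) AB).
have le2 := IHs _ _ _ lts (trace_powerset x BY) (link_powerset x AY)
  (trace_neq0 x FB) (link_neq0 FA xF)
  (cross_union_trace_link (x := x) (cross_union_sym AB)).
have leA := card_trace_link x A; have leB := card_trace_link x B.
have sum_le a b ta la tb lb p c : ta + lb <= 1 + p -> tb + la <= 1 + p ->
  a <= ta + la -> b <= tb + lb -> a + b + c <= 2 + (p + c + p) by lia.
by rewrite cardY binsum_pascal binsumS /=; apply: sum_le le1 le2 leA leB.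
Qed.

(** The union of the families lies among the sets of size at most [s], and their
    intersection accounts for the extra 1. *)
Lemma card_nonoverlap s Y A B :
  A \subset powerset Y -> B \subset powerset Y -> A != set0 -> B != set0 ->
  cross_union s A B -> A :&: B \subset [set set0] ->
  #|A| + #|B| <= 1 + binsum #|Y| s.
Proof.
move=> AY BY A0 B0 AB AB0; rewrite -cardsUI addnC -card_subsets_upto.
rewrite leq_add //; first by rewrite -(cards1 (set0 : {set T})) subset_leq_card.
apply: subset_leq_card; apply/subsetP => F.
have /subsetP sA := cross_union_small B0 AB.
have /subsetP sB := cross_union_small A0 (cross_union_sym AB).
by rewrite !inE -powersetE => /orP[FA|FB]; [move/sA: (FA)|move/sB: (FB)];
  rewrite inE => ->; rewrite ?(subsetP AY _ FA) ?(subsetP BY _ FB).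
Qed.

Lemma overlapP A B :
  A :&: B \subset [set set0] \/ exists F x, [/\ F \in A, F \in B & x \in F].
Proof.
have [AB0|/subsetPn[F]] := boolP (A :&: B \subset [set set0]); first by left.
rewrite !inE => /andP[FA FB] /set0Pn[x xF]; right; by exists F, x.
Qed.

Lemma cross_union_bound s : bounded_at s.
Proof.
elim: s => [|s IHs] Y A B ltsY AY BY A0 B0 AB;
  have [AB0|[F [x [FA FB xF]]]] := overlapP A B; try exact: card_nonoverlap AB0.
- (* a nonempty common member would have size at most 0 *)
  have := subsetP (cross_union_small B0 AB) _ FA.
  by rewrite inE leqn0 cards_eq0 => /eqP F0; rewrite F0 inE in xF.
- have := cross_union_overlap IHs ltsY AY BY FA FB xF AB.
  have : 0 < 'C(#|Y|.-1, s.+1) by rewrite bin_gt0; lia.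
  by lia.
Qed.

(** * Equality *)

(** If [F] is missing from [A] and [G] from [B], then [F] is in [B] and [G] in
    [A], and their union is too large unless they coincide. *)
Lemma layer_in_one_family s A B :
  cross_union s A B -> A :|: B = sets_upto T s ->
  (forall F, #|F| = s -> F \in A) \/ (forall F, #|F| = s -> F \in B).
Proof.
move=> AB ABU.
have inU F : #|F| = s -> F \in A :|: B by rewrite ABU inE => ->.
have [/forallP hA|/forallPn[F]] :=
  boolP [forall F : {set T}, (#|F| == s) ==> (F \in A)].
  by left=> F /eqP Fs; have := hA F; rewrite Fs.
rewrite negb_imply => /andP[/eqP Fs nFA]; right => G Gs; apply: contraT => nGB.
have FB : F \in B by move: (inU F Fs); rewrite inE (negbTE nFA).
have GA : G \in A by move: (inU G Gs); rewrite inE (negbTE nGB) orbF.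
(* the union has at most s elements, so it equals both F and G *)
have UG : G = G :|: F by apply/eqP; rewrite eqEcard subsetUl Gs AB.
have UF : F = G :|: F by apply/eqP; rewrite eqEcard subsetUr Fs AB.
by rewrite UF -UG GA in nFA.
Qed.

(** A nonempty set with a point [x] is not contained in an [s]-set avoiding [x],
    so their union exceeds [s]. *)
Lemma layer_forces_empty s A B :
  s < #|T| -> cross_union s A B -> (forall F, #|F| = s -> F \in A) ->
  B \subset [set set0].
Proof.
move=> sT AB hA; apply/subsetP => G GB; rewrite inE; apply: contraT => /set0Pn[x xG].
have [F /subsetP Fx Fs] : exists2 F : {set T}, F \subset [set~ x] & #|F| = s.
  have : 0 < #|[set F : {set T} | F \subset [set~ x] & #|F| == s]|.
    by rewrite cards_draws bin_gt0 cardsC1; lia.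
  by case/card_gt0P => F; rewrite inE => /andP[? /eqP]; exists F.
have xF : x \notin F by apply/negP => /Fx; rewrite !inE eqxx.
have := AB _ _ (hA F Fs) GB; apply: contraTT => _; rewrite -ltnNge -Fs.
apply: proper_card; rewrite properE subsetUl; apply/subsetPn.
by exists x; rewrite // inE xG orbT.
Qed.

Lemma full_layer_pair s A B :
  s < #|T| -> cross_union s A B -> A :&: B = [set set0] ->
  A :|: B = sets_upto T s -> (forall F, #|F| = s -> F \in A) ->
  A = sets_upto T s /\ B = [set set0].
Proof.
move=> sT AB ABI ABU hA.
have B0 : B = [set set0].
  by apply/eqP; rewrite eqEsubset (layer_forces_empty sT AB hA) -ABI subsetIr.
by split=> //; rewrite -ABU B0; apply/esym/setUidPl; rewrite -ABI subsetIl.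
Qed.

Lemma cross_union_extremal s A B :
  0 < s -> s < #|T|.-1 -> A != set0 -> B != set0 -> cross_union s A B ->
  #|A| + #|B| = 1 + binsum #|T| s ->
  [set A; B] = [set [set set0]; sets_upto T s].
Proof.
move=> s0 sT A0 B0 AB eqAB.
have [AB0|[F [x [FA FB xF]]]] := overlapP A B; last first.
  case: s s0 sT AB eqAB => // s _ sT AB eqAB.
  have pT (C : {set {set T}}) : C \subset powerset [set: T].
    by rewrite powersetT subsetT.
  have ltT : s.+1 < #|[set: T]| by rewrite cardsT; lia.
  have := cross_union_overlap (@cross_union_bound s) ltT (pT A) (pT B) FA FB xF AB.
  rewrite cardsT => le; have := bin_ge2 (m := #|T|.-1) (k := s.+1) sT.
  by lia.
have subU : A :|: B \subset sets_upto T s.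
  by rewrite subUset (cross_union_small B0 AB)
             (cross_union_small A0 (cross_union_sym AB)).
have leI := subset_leq_card AB0; rewrite cards1 in leI.
have cardP := card_sets_upto T s.
have leU := subset_leq_card subU; have := cardsUI A B => UI.
have ABU : A :|: B = sets_upto T s by apply/eqP; rewrite eqEcard subU; lia.
have ABI : A :&: B = [set set0] by apply/eqP; rewrite eqEcard AB0 cards1; lia.
have sT' : s < #|T| by lia.
have [hA|hB] := layer_in_one_family AB ABU.
  by have [-> ->] := full_layer_pair sT' AB ABI ABU hA; rewrite setUC.
rewrite setIC in ABI; rewrite setUC in ABU.
by have [-> ->] := full_layer_pair sT' (cross_union_sym AB) ABI ABU hB.
Qed.

End CrossUnion.

Lemma eq_set2 (T : finType) (a b c d : T) :
  [set a; b] = [set c; d] -> a = c /\ b = d \/ a = d /\ b = c.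
Proof.
move=> /setP eqS; have := (eqS a, eqS b, eqS c, eqS d).
rewrite !inE !eqxx ?orbT /= => -[[[/esym/orP ea /esym/orP eb] /orP ec] /orP ed].
case: ea => /eqP ea; subst a; case: eb => /eqP eb; subst b; try by [left | right].
- by case: ed => /eqP ->; left.
- by case: ec => /eqP ->; left.
Qed.

Theorem theorem1p6 (n s : nat) (hs : 0 < s) (hsn : s < n)
  (X : finType) (hX : #|X| = n) (A B : {set {set X}})
  (hA : A != set0) (hB : B != set0) (hAB : cross_union s A B) :
  [/\ #|A| + #|B| <= 1 + \sum_(0 <= i < s.+1) 'C(n, i),
      [set A; B] = [set [set set0]; sets_upto X s] ->
        #|A| + #|B| = 1 + \sum_(0 <= i < s.+1) 'C(n, i)
    & s < n.-1 ->
        #|A| + #|B| = 1 + \sum_(0 <= i < s.+1) 'C(n, i) ->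
        [set A; B] = [set [set set0]; sets_upto X s]].
Proof.
rewrite -/(binsum n s); subst n; split; last by move=> *; exact: cross_union_extremal.
- by rewrite -cardsT in hsn *; apply: cross_union_bound;
    rewrite // powersetT subsetT.
- move=> eqAB.
  rewrite -card_sets_upto -(cards1 (set0 : {set X})).
  by have [[-> ->]|[-> ->]] := eq_set2 eqAB; rewrite // addnC.
Qed.
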